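(* Let $\mathbf{x}$ be a sequence over a finite alphabet that is not eventually periodic. Then: (a) for all $n \geq 1$, $r_{\mathbf{x}}(n) \geq 1 + \left\lfloor \frac{n+1}{2} \right\rfloor$; (b) $r_{\mathbf{x}}(n) = 1 + \left\lfloor \frac{n+1}{2} \right\rfloor$ for all $n\ge 1$ if and only if $\mathbf{x}$ is Sturmian.
   Context: A sequence is an infinite word $\mathbf{x}=x(1)x(2)\cdots$ over a finite alphabet. A factor is a finite contiguous block of $\mathbf{x}$. For a finite word $u=u(1)\cdots u(m)$, its reversal is $u^R=u(m)\cdots u(1)$. Two finite words $u,v$ are reflectively equivalent if $v=u$ or $v=u^R$. The reflection complexity $r_{\mathbf{x}}(n)$ is the number of distinct length-$n$ factors of $\mathbf{x}$ up to reflective equivalence. The factor complexity $\rho_{\mathbf{x}}(n)$ is the number of distinct length-$n$ factors. $\mathbf{x}$ is eventually periodic if $\mathbf{x}=uv^\omega$ for finite words $u,v$ with $v$ nonempty. $\mathbf{x}$ is Sturmian if $\rho_{\mathbf{x}}(n)=n+1$ for all $n\ge 0$. *)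

(* Defs.v *)
From mathcomp Require Import all_boot boolp.

Set Implicit Arguments.
Unset Strict Implicit.
Unset Printing Implicit Defensive.

(* A sequence over the finite alphabet [A] is a function [x : nat -> A]; its
   letters are numbered from 0, so that [x k] is the letter x(k+1) of the usual
   1-based notation. *)

Definition block (A : Type) (x : nat -> A) (i n : nat) : n.-tuple A :=
  [tuple x (i + k) | k < n].

Definition factors (A : finType) (x : nat -> A) (n : nat) : {set n.-tuple A} :=
  [set w | `[< exists i, w = block x i n >]].

Definition factor_complexity (A : finType) (x : nat -> A) (n : nat) : nat :=
  #|factors x n|.

Definition reflectively_equivalent (A : eqType) (u v : seq A) : bool :=
  (v == u) || (v == rev u).

Lemma reflectively_equivalentP (A : eqType) :
  equivalence_rel (@reflectively_equivalent A).
Proof.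
move=> u v w; rewrite /reflectively_equivalent eqxx; split=> //.
by case/orP=> /eqP->; rewrite ?revK // orbC.
Qed.

Definition reflection_complexity (A : finType) (x : nat -> A) (n : nat) : nat :=
  #|equivalence_partition
      (fun u v : n.-tuple A => reflectively_equivalent u v) (factors x n)|.

(* The periodic word v v v ... for the nonempty word v = a :: s. *)
Definition omega_power (A : Type) (a : A) (s : seq A) : nat -> A :=
  fun k => nth a (a :: s) (k %% size (a :: s)).

(* The default [y 0] of [nth] is never used. *)
Definition prepend (A : Type) (u : seq A) (y : nat -> A) : nat -> A :=
  fun k => if k < size u then nth (y 0) u k else y (k - size u).

Definition eventually_periodic (A : Type) (x : nat -> A) : Prop :=
  exists (u : seq A) (a : A) (s : seq A), x =1 prepend u (omega_power a s).

Definition sturmian (A : finType) (x : nat -> A) : Prop :=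
  forall n : nat, factor_complexity x n = n + 1.

(* Main.v *)
(* Let rho and r be the factor and reflection complexities. Every reflection
   class of factors of length n is a pair {w, w^R} or a singleton, so
   2 r(n) = rho(n) + q(n), where q(n) counts the singletons: palindromes, and
   factors whose reversal is not a factor. By Morse-Hedlund rho(n) >= n + 1.
   As long as rho grows by one and the factors are closed under reversal, a
   palindromic factor v extends to a palindromic factor a v a: either v has a
   single right extension, or v is the only right special factor of its length
   and is extended by some right special factor c v, with c = a by counting.
   Hence q cannot vanish at an odd length n with rho(n) = n + 1, which gives the
   lower bound, and q(k + 2) >= q(k) at the first length k + 2 where
   rho(k + 2) > k + 3, which contradicts r(k + 2) = r(k) + 1. Conversely the
   factors of a Sturmian word are closed under reversal and each palindrome v
   extends to only one a v a, so q(n) is at most 1 (n even) or 2 (n odd). *)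
Require Import Defs.
From mathcomp Require Import all_boot.
From mathcomp Require Import boolp zify.

Set Implicit Arguments.
Unset Strict Implicit.
Unset Printing Implicit Defensive.

Section Words.

Variable A : finType.
Implicit Types (x : nat -> A) (u v w : seq A) (a b c : A) (i j k m n : nat).

(** * Words and factors read off a sequence *)

Definition word x i n : seq A := mkseq (fun k => x (i + k)) n.

Definition factor x w : Prop := exists i, w = word x i (size w).

Lemma size_word x i n : size (word x i n) = n.
Proof. exact: size_mkseq. Qed.

Lemma wordSr x i n : word x i n.+1 = rcons (word x i n) (x (i + n)).
Proof. by rewrite /word /mkseq -addn1 iotaD map_cat cats1. Qed.

Lemma wordSl x i n : word x i n.+1 = x i :: word x i.+1 n.
Proof.
rewrite /word /mkseq /= addn0 -[1]addn0 iotaDl -map_comp.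
by congr (_ :: _); apply: eq_map => k /=; rewrite add1n addnS.
Qed.

Lemma nth_word d x i n k : k < n -> nth d (word x i n) k = x (i + k).
Proof. exact: nth_mkseq. Qed.

Lemma val_block x i n : tval (block x i n) = word x i n.
Proof.
apply: (@eq_from_nth _ (x 0)); rewrite !size_tuple ?size_word// => k kn.
by rewrite nth_word// -[k]/(val (Ordinal kn)) -tnth_nth tnth_mktuple.
Qed.

Lemma factor_word x i n : factor x (word x i n).
Proof. by exists i; rewrite size_word. Qed.

Lemma mem_factors x n (w : n.-tuple A) :
  reflect (factor x w) (w \in factors x n).
Proof.
rewrite inE; apply: (iffP (asboolP _)) => -[i wE]; exists i.
  by rewrite size_tuple wE val_block.
by apply: val_inj; rewrite [RHS]val_block [LHS]wE size_tuple.
Qed.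

Lemma factor_rcons x w a :
  factor x (rcons w a) ->
  exists i, w = word x i (size w) /\ a = x (i + size w).
Proof.
case=> i; rewrite size_rcons wordSr => /eqP.
by rewrite eqseq_rcons => /andP[/eqP wE /eqP aE]; exists i.
Qed.

Lemma factor_cons x w a :
  factor x (a :: w) -> exists i, w = word x i.+1 (size w) /\ a = x i.
Proof.
by case=> i; rewrite /= wordSl => -[-> ->]; exists i; rewrite size_word.
Qed.

Lemma factor_belast x w a : factor x (rcons w a) -> factor x w.
Proof. by case/factor_rcons=> i [-> _]; exact: factor_word. Qed.

Lemma factor_behead x w a : factor x (a :: w) -> factor x w.
Proof. by case/factor_cons=> i [-> _]; exact: factor_word. Qed.

Lemma factor_extend_right x w : factor x w -> exists a, factor x (rcons w a).
Proof.
case=> i wE; exists (x (i + size w)).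
by rewrite {1}wE -wordSr; exact: factor_word.
Qed.

(** * Repetitions that force eventual periodicity *)

Lemma eventually_periodic_shift x N p :
  0 < p -> (forall i, N <= i -> x (i + p) = x i) -> eventually_periodic x.
Proof.
move=> p0 xp.
have xpM q i : N <= i -> x (i + q * p) = x i.
  by move=> Ni; elim: q => [|q IH]; rewrite ?addn0// mulSnr addnA xp ?IH//; lia.
exists (word x 0 N), (x N), (word x N.+1 p.-1) => k.
rewrite /prepend size_word; case: ltnP => kN; first by rewrite nth_word.
rewrite /omega_power -wordSl size_word prednK// nth_word ?ltn_pmod//.
rewrite -[in LHS](subnKC kN) {1}(divn_eq (k - N) p) addnCA addnC xpM//.
exact: leq_addr.
Qed.

Lemma eventually_periodic_tail x :
  eventually_periodic (fun i => x i.+1) -> eventually_periodic x.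
Proof.
by case=> u [a [s xE]]; exists (x 0 :: u), a, s => -[|k].
Qed.

(** The words at [p + t] and [q + t] stay equal for every [t]: both equal the word at some [j] in
    the window from [p] to [q], where the next letter is determined, and [j] wraps from [q] back to
    [p]. This gives the period [q - p]. *)
Lemma repeat_eventually_periodic x m p q :
  p < q -> word x p m = word x q m ->
  (forall i j, p <= j < q -> word x i m = word x j m ->
     x (i + m) = x (j + m)) ->
  eventually_periodic x.
Proof.
move=> pq wpq next.
have step t : exists j, [/\ p <= j < q, word x (p + t) m = word x j m
                          & word x (q + t) m = word x j m].
  elim: t => [|t [j [jpq w1 w2]]].
    by exists p; rewrite !addn0 leqnn pq; split.
  have succ i : word x i m = word x j m -> word x i.+1 m = word x j.+1 m.
    move=> wi; have: word x i m.+1 = word x j m.+1.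
      by rewrite !wordSr wi (next _ _ jpq wi).
    by rewrite !wordSl => -[].
  have [jq|jq] := ltnP j.+1 q.
    by exists j.+1; rewrite !addnS !succ// jq leqW//; case/andP: jpq.
  have jE : j.+1 = q by lia.
  by exists p; rewrite !addnS !succ// jE wpq leqnn pq.
apply: (@eventually_periodic_shift _ (p + m) (q - p)).
  by rewrite subn_gt0.
move=> i pmi; have [j [jpq w1 w2]] := step (i - (p + m)).
have := next _ _ jpq w1; rewrite -(next _ _ jpq w2).
have -> : p + (i - (p + m)) + m = i by lia.
by have -> : q + (i - (p + m)) + m = i + (q - p) by lia.
Qed.

Lemma word_collision x n (S : {set n.-tuple A}) i :
  (forall k, k <= #|S| -> block x (i + k) n \in S) ->
  exists p q, [/\ i <= p, p < q, q <= i + #|S| & word x p n = word x q n].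
Proof.
move=> inS; pose f (k : 'I_#|S|.+1) := block x (i + k) n.
have /injectivePn[k1 [k2 k12 fE]] : ~~ injectiveb f.
  apply/negP => /injectiveP/card_codom; rewrite card_ord => cf.
  have : #|codom f| <= #|S|; last by rewrite cf ltnn.
  apply/subset_leq_card/subsetP => _ /codomP[k ->].
  by apply: inS; rewrite -ltnS.
have wE : word x (i + k1) n = word x (i + k2) n.
  by rewrite -!val_block [block _ _ _]fE.
have := ltn_ord k1; have := ltn_ord k2; rewrite !ltnS => l2 l1.
case: (ltngtP k1 k2) => lt12.
- by exists (i + k1), (i + k2); split; rewrite ?leq_addr ?ltn_add2l ?leq_add2l.
- by exists (i + k2), (i + k1); split; rewrite ?leq_addr ?ltn_add2l ?leq_add2l.
- by case/eqP: k12; apply: val_inj.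
Qed.

(** * Right special factors and growth of the factor complexity *)

(** Otherwise each word of length [n] determines the letter after it, and by pigeonhole some word
    recurs, so [x] would be eventually periodic. *)
Lemma right_special_exists x n : ~ eventually_periodic x ->
  exists w a b, [/\ size w = n, a != b, factor x (rcons w a)
                  & factor x (rcons w b)].
Proof.
move=> aper; apply: contrapT => noRS; apply: aper.
have [|p [q [_ pq _ wE]]] := @word_collision x n [set: n.-tuple A] 0.
  by move=> k _; rewrite inE.
apply: (repeat_eventually_periodic pq wE) => i j _ wij.
apply: contrapT => /eqP neq; apply: noRS.
exists (word x i n), (x (i + n)), (x (j + n)); rewrite size_word; split=> //.
  by rewrite -wordSr; exact: factor_word.
by rewrite wij -wordSr; exact: factor_word.
Qed.

Definition belast_word n (w : n.+1.-tuple A) : n.-tuple A :=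
  [tuple of rev (behead (rev w))].

Lemma belast_word_rcons n (v : n.-tuple A) a :
  belast_word [tuple of rcons v a] = v.
Proof. by apply: val_inj; rewrite /= rev_rcons /= revK. Qed.

(** Dropping the last letter maps the factors of length [n.+1] onto those of length [n], and remains
    onto when the redundant extensions in [D] are removed. *)
Lemma factor_complexity_growth x n (D : {set n.+1.-tuple A}) :
  D \subset factors x n.+1 ->
  (forall d, d \in D ->
     exists2 u, u \in factors x n.+1 :\: D & belast_word u = belast_word d) ->
  factor_complexity x n + #|D| <= factor_complexity x n.+1.
Proof.
move=> DF Dext; rewrite /factor_complexity -(cardsID D (factors x n.+1)).
rewrite (setIidPr DF) addnC leq_add2l.
apply: leq_trans (leq_imset_card (@belast_word n) _).
apply/subset_leq_card/subsetP => v /mem_factors fv.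
have [a fva] := factor_extend_right fv.
pose w : n.+1.-tuple A := [tuple of rcons v a].
have wv : belast_word w = v by exact: belast_word_rcons.
have wF : w \in factors x n.+1 by apply/mem_factors.
have [wD|wD] := boolP (w \in D).
  by rewrite -wv; have [u uF <-] := Dext w wD; apply: imset_f.
by rewrite -wv; apply: imset_f; rewrite inE wD.
Qed.

Lemma factor_complexity_ltS x n : ~ eventually_periodic x ->
  factor_complexity x n < factor_complexity x n.+1.
Proof.
move=> /(@right_special_exists x n) [w [a [b [/eqP sw ab fa fb]]]].
pose ext c : n.+1.-tuple A := [tuple of rcons (Tuple sw) c].
rewrite -addn1 -(cards1 (ext b)); apply: factor_complexity_growth.
  by rewrite sub1set; apply/mem_factors.
move=> d /set1P->; exists (ext a).
  rewrite in_setD in_set1 -val_eqE /= eqseq_rcons eqxx /= ab.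
  exact/mem_factors.
by rewrite /ext !belast_word_rcons.
Qed.

(** The extensions by [c1] and [c2] are the redundant ones; those by [a1] and [a2] are kept. Taking
    [v1] and [v2] distinct or equal covers two right special words as well as one word with three
    extensions. *)
Lemma factor_complexity_ltD2 x n v1 v2 a1 a2 c1 c2 :
  size v1 = n -> size v2 = n ->
  factor x (rcons v1 a1) -> factor x (rcons v2 a2) ->
  factor x (rcons v1 c1) -> factor x (rcons v2 c2) ->
  rcons v1 c1 != rcons v2 c2 ->
  rcons v1 a1 \notin [:: rcons v1 c1; rcons v2 c2] ->
  rcons v2 a2 \notin [:: rcons v1 c1; rcons v2 c2] ->
  factor_complexity x n + 1 < factor_complexity x n.+1.
Proof.
move=> /eqP s1 /eqP s2 fa1 fa2 fc1 fc2 c12 na1 na2.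
pose ext v (sv : size v == n) c : n.+1.-tuple A :=
  [tuple of rcons (Tuple sv) c].
suff : factor_complexity x n + #|[set ext _ s1 c1; ext _ s2 c2]|
       <= factor_complexity x n.+1.
  by rewrite cards2 -val_eqE /= c12 addn2 addn1.
apply: factor_complexity_growth.
  by apply/subsetP => u /set2P[]->; apply/mem_factors.
move=> d /set2P[]->.
  exists (ext _ s1 a1); last by rewrite /ext !belast_word_rcons.
  rewrite in_setD; apply/andP; split; last exact/mem_factors.
  by rewrite !inE -!val_eqE in na1 *.
exists (ext _ s2 a2); last by rewrite /ext !belast_word_rcons.
rewrite in_setD; apply/andP; split; last exact/mem_factors.
by rewrite !inE -!val_eqE in na2 *.
Qed.

Lemma right_special_unique x n v1 v2 a1 a2 b1 b2 :
  factor_complexity x n.+1 <= factor_complexity x n + 1 ->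
  size v1 = n -> size v2 = n ->
  a1 != b1 -> factor x (rcons v1 a1) -> factor x (rcons v1 b1) ->
  a2 != b2 -> factor x (rcons v2 a2) -> factor x (rcons v2 b2) ->
  v1 = v2.
Proof.
move=> le s1 s2 ab1 fa1 fb1 ab2 fa2 fb2; apply: contrapT => /eqP v12.
move: le; rewrite leqNgt => /negP; apply.
apply: (factor_complexity_ltD2 s1 s2 fa1 fa2 fb1 fb2).
- by rewrite eqseq_rcons negb_and v12.
- by rewrite !inE !eqseq_rcons (negPf v12) eqxx (negPf ab1).
- by rewrite !inE !eqseq_rcons eq_sym (negPf v12) eqxx (negPf ab2).
Qed.

Lemma right_special_two_letters x n v a b c :
  factor_complexity x n.+1 <= factor_complexity x n + 1 ->
  size v = n -> a != b ->
  factor x (rcons v a) -> factor x (rcons v b) -> factor x (rcons v c) ->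
  c = a \/ c = b.
Proof.
move=> le sv ab fa fb fc; apply: contrapT => /not_orP[/eqP ca /eqP cb].
move: le; rewrite leqNgt => /negP; apply.
apply: (factor_complexity_ltD2 sv sv fc fc fa fb).
- by rewrite eqseq_rcons eqxx.
- by rewrite !inE !eqseq_rcons eqxx (negPf ca) (negPf cb).
- by rewrite !inE !eqseq_rcons eqxx (negPf ca) (negPf cb).
Qed.

Lemma factor_complexity0 x : factor_complexity x 0 = 1.
Proof.
rewrite /factor_complexity -(cards1 ([tuple] : 0.-tuple A)).
apply: eq_card => w; rewrite (tuple0 w) in_set1 eqxx; apply/mem_factors.
exact: (factor_word x 0 0).
Qed.

Lemma morse_hedlund x n : ~ eventually_periodic x -> n < factor_complexity x n.
Proof.
move=> aper; elim: n => [|n IH]; first by rewrite factor_complexity0.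
exact: leq_ltn_trans IH (factor_complexity_ltS n aper).
Qed.

Lemma factor_complexity_leD x k d : ~ eventually_periodic x ->
  factor_complexity x k + d <= factor_complexity x (k + d).
Proof.
move=> aper; elim: d => [|d IH]; first by rewrite !addn0.
by rewrite !addnS; exact: leq_ltn_trans IH (factor_complexity_ltS _ aper).
Qed.

(** * Closure under reversal and palindromic extensions *)

Definition reversal_closed x n : Prop :=
  forall w, size w = n -> factor x w -> factor x (rev w).

Lemma reversal_closedW x n : reversal_closed x n.+1 -> reversal_closed x n.
Proof.
move=> cl w sw /factor_extend_right[a].
move/cl; rewrite size_rcons sw rev_rcons => /(_ erefl).
exact: factor_behead.
Qed.

Lemma reversal_closed_le x k n :
  k <= n -> reversal_closed x n -> reversal_closed x k.
Proof.
move=> /subnK <-; elim: (n - k) => [//|d IH] /reversal_closedW; exact: IH.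
Qed.

Lemma palindrome_extend x k v :
  ~ eventually_periodic x -> reversal_closed x k.+2 ->
  factor_complexity x k.+1 <= factor_complexity x k + 1 ->
  size v = k -> rev v = v -> factor x v ->
  exists a, factor x (a :: rcons v a).
Proof.
move=> aper cl le sv vpal fv.
have flip a b : factor x (a :: rcons v b) -> factor x (b :: rcons v a).
  move/cl; rewrite /= size_rcons sv => /(_ erefl).
  by rewrite rev_cons rev_rcons vpal.
have [w' [a [b [sw ab]]]] := right_special_exists k.+1 aper.
case: w' sw => [//|c w] /= [sw] fa fb.
(* If [v] is [w], reversing [c v a] shows that [c] also follows [v], so [c] is [a] or [b]. *)
have [vw|vw] := EM (v = w).
  rewrite -vw in fa fb.
  have [ca|cb] := right_special_two_letters le sv ab (factor_behead fa)
    (factor_behead fb) (factor_behead (flip _ _ fa)).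
  - by exists a; rewrite -{1}ca.
  - by exists b; rewrite -{1}cb.
(* Now [v] is not right special. Reversing [v c' d] puts [c'] before [v]; the letter [e] after this
   [c' v] must again be [c']. *)
have [c' fc] := factor_extend_right fv; have [d fd] := factor_extend_right fc.
have := cl _ _ fd; rewrite !size_rcons sv !rev_rcons vpal => /(_ erefl).
move=> /factor_behead /factor_extend_right[e fe].
exists c'; suff eE : e = c' by rewrite -{2}eE.
apply: contrapT => /eqP ec; apply: vw.
exact: (right_special_unique le sv sw ec (factor_behead fe) fc ab
  (factor_behead fa) (factor_behead fb)).
Qed.

(* If [w] occurred only as a prefix of [x], the tail of [x] would have at most
   [n] factors of length [n], against the Morse-Hedlund bound. *)
Lemma factor_extend_left x n w :
  ~ eventually_periodic x -> factor_complexity x n <= n.+1 ->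
  size w = n -> factor x w -> exists c, factor x (c :: w).
Proof.
move=> aper le /eqP sw fw; apply: contrapT => noext.
have taper : ~ eventually_periodic (fun i => x i.+1).
  by move=> /eventually_periodic_tail.
have := morse_hedlund n taper; rewrite ltnNge => /negP; apply.
have wF : Tuple sw \in factors x n by apply/mem_factors.
rewrite -ltnS; apply: leq_trans le.
rewrite /factor_complexity (cardsD1 (Tuple sw) (factors x n)) wF add1n ltnS.
apply/subset_leq_card/subsetP => u /mem_factors[i uE].
have {}uE : tval u = word x i.+1 n.
  by rewrite uE size_tuple; apply: eq_map => k; rewrite addSn.
rewrite in_setD1; apply/andP; split.
  apply/eqP => uw; apply: noext; exists (x i).
  have -> : w = word x i.+1 n by rewrite -uE uw.
  by rewrite -wordSl; exact: factor_word.
by apply/mem_factors; rewrite uE; exact: factor_word.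
Qed.

(* The bispecial case, after Lothaire: [b :: v] would always be followed by [b],
   and the right special word [a :: v] starts at none of the [k + 2] positions of
   such an occurrence, because [v] is a palindrome. Only [k + 1] words remain for
   these positions, so one of them repeats, and [x] is periodic from there on. *)
Lemma palindrome_bispecial x k v a b :
  ~ eventually_periodic x ->
  factor_complexity x k.+1 <= k.+2 ->
  factor_complexity x k.+1 <= factor_complexity x k + 1 ->
  factor_complexity x k.+2 <= factor_complexity x k.+1 + 1 ->
  size v = k -> rev v = v -> a != b ->
  factor x (a :: rcons v a) -> factor x (a :: rcons v b) ->
  factor x (b :: v) -> factor x (b :: rcons v a).
Proof.
move=> aper le1 le2 le3 sv vpal ab faa fab fb; apply: contrapT => nba.
have [i] := factor_cons fb; rewrite sv => -[vE bE].
have xb : x (i + k.+1) = b.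
  have fbx : factor x (b :: rcons v (x (i + k.+1))).
    rewrite -[i + k.+1]addSnnS {1}vE -wordSr bE -wordSl; exact: factor_word.
  have [xa|//] := right_special_two_letters le2 sv ab (factor_behead faa)
    (factor_behead fab) (factor_behead fbx).
  by case: nba; rewrite -xa.
have avoid j : j <= k.+1 -> word x (i + j) k.+1 <> a :: v.
  case: j => [_|j]; rewrite wordSl.
    by rewrite addn0 -bE => -[ba]; rewrite ba eqxx in ab.
  rewrite ltnS leq_eqVlt => /orP[/eqP ->|jk] [xa vE'].
    by rewrite -xa xb eqxx in ab.
  (* The copy of [v] at [i.+1] has [a] at index [j]. The copy inside the supposed [a :: v] has at
     the mirror index [k - j.+1] the letter at position [i + k.+1], which is [b]. *)
  have nj : nth a v j = a by rewrite {1}vE nth_word// addSnnS.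
  have : nth a v (k - j.+1) = b.
    rewrite -vE' nth_word; last by lia.
    by rewrite -xb; congr (x _); lia.
  rewrite -{1}vpal nth_rev sv; last by lia.
  have -> : k - (k - j.+1).+1 = j by lia.
  by rewrite nj => /eqP; rewrite (negPf ab).
have sav : size (a :: v) == k.+1 by rewrite /= sv.
pose S := factors x k.+1 :\ Tuple sav.
have avF : Tuple sav \in factors x k.+1.
  by apply/mem_factors; move: faa; rewrite -rcons_cons => /factor_belast.
have cS : #|S| <= k.+1.
  by move: le1; rewrite /factor_complexity (cardsD1 (Tuple sav)) avF.
have [|p [q [ip pq qi wpq]]] := @word_collision x k.+1 S i.
  move=> j jS; rewrite in_setD1; apply/andP; split.
    apply/eqP => /(congr1 val); rewrite [LHS]val_block; apply: avoid; lia.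
  by apply/mem_factors; rewrite val_block; exact: factor_word.
apply: aper; apply: (repeat_eventually_periodic pq wpq) => i' j jpq wij.
apply: contrapT => /eqP neq.
have jE : i + (j - i) = j by lia.
apply: (@avoid (j - i)); first by lia.
rewrite jE.
apply: (right_special_unique (v2 := a :: v) le3 _ _ neq _ _ ab faa fab).
- exact: size_word.
- exact/eqP.
- by rewrite -wij -wordSr; exact: factor_word.
- by rewrite -wordSr; exact: factor_word.
Qed.

(** Induction on the length. For a factor [a v b], both [b v^R] and [v^R a] are factors. If
    [b v^R a] is not, they extend to [b v^R c] and [d v^R a] with [c] other than [a] and [d] other
    than [b]. Then [v^R] and [v] are both right special, hence equal, and the bispecial case
    applies. *)
Lemma sturmian_reversal_closed x : ~ eventually_periodic x ->
  sturmian x -> forall n, reversal_closed x n.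
Proof.
move=> aper st.
have le n : factor_complexity x n.+1 <= factor_complexity x n + 1.
  by rewrite !st; lia.
have le' n : factor_complexity x n <= n.+1 by rewrite st addn1.
elim=> [|[|k] IH] [|a w] // sw fw.
  by case: w sw fw.
case/lastP: w sw fw => [//|v b] /=; rewrite size_rcons => -[sv] fw.
rewrite rev_cons rev_rcons.
have fva : factor x (rcons (rev v) a).
  rewrite -rev_cons; apply: IH; first by rewrite /= sv.
  by move: fw; rewrite -rcons_cons => /factor_belast.
have fvb := factor_behead fw.
have fbv : factor x (b :: rev v).
  by rewrite -rev_rcons; apply: IH; rewrite ?size_rcons ?sv.
have [c fc] := factor_extend_right fbv.
have [->|ac] := eqVneq a c; first by [].
have srv : size (rcons (rev v) a) = k.+1 by rewrite size_rcons size_rev sv.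
have [d fd] := factor_extend_left aper (le' _) srv fva.
have [->|bd] := eqVneq b d; first by [].
have fvd : factor x (rcons v d).
  rewrite -[v]revK -rev_cons; apply: IH; first by rewrite /= size_rev sv.
  by move: fd; rewrite -rcons_cons => /factor_belast.
have vpal : rev v = v.
  apply: (right_special_unique (le k) _ sv ac fva (factor_behead fc) bd fvb
    fvd).
  by rewrite size_rev.
rewrite vpal in fva fd fbv *.
have [ab|ab] := eqVneq a b; first by rewrite -ab {2}ab.
have [da|db] := right_special_two_letters (le k) sv ab fva fvb fvd.
  rewrite da in fd.
  exact: (palindrome_bispecial aper (le' _) (le _) (le _) sv vpal ab fd fw fbv).
by rewrite db eqxx in bd.
Qed.

(** * Reflection classes and unpaired words *)

(* The words that are alone in their reflection class. *)
Definition unpaired x n : {set n.-tuple A} :=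
  [set w in factors x n |
    ([tuple of rev w] == w) || ([tuple of rev w] \notin factors x n)].

Lemma reflection_complexity_double x n :
  2 * reflection_complexity x n = factor_complexity x n + #|unpaired x n|.
Proof.
pose R (u v : n.-tuple A) := reflectively_equivalent u v.
pose S := factors x n.
rewrite /reflection_complexity; set P := equivalence_partition _ _.
have partP : partition P S.
  apply: (@equivalence_partitionP _ R) => u v w _ _ _.
  exact: reflectively_equivalentP.
(* Give unpaired factors weight 2 and the others weight 1; each class then has total weight 2. *)
have -> : factor_complexity x n + #|unpaired x n| =
          \sum_(w in S) (1 + (w \in unpaired x n)).
  rewrite big_split /= sum1_card; congr (_ + _).
  rewrite -sum1_card big_mkcond [in RHS]big_mkcond /=; apply: eq_bigr => w _.
  by rewrite in_set -/S; case: (w \in S) => //=; case: (_ || _).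
have /and3P[/eqP covP trivP _] := partP.
rewrite -[in RHS]covP big_trivIset//= [LHS]mulnC -sum_nat_const.
apply: eq_bigr => B /imsetP[w wS ->].
have [w' w'E ww'] : exists2 w' : n.-tuple A,
    [tuple of rev w] = w' & [tuple of rev w'] = w.
  by exists [tuple of rev w] => //; apply: val_inj; rewrite /= revK.
have BE (u : n.-tuple A) :
    (u \in [set y in S | R w y]) = (u == w) || (u == w') && (w' \in S).
  rewrite in_set /R /reflectively_equivalent.
  have -> : (tval u == rev w) = (u == w') by rewrite -w'E.
  rewrite (_ : (tval u == w) = (u == w))//.
  have [->|_] := eqVneq u w; first by rewrite wS.
  by case: eqVneq => [->|_]; rewrite ?andbT ?andbF.
rewrite (eq_bigl _ _ BE).
have QE (u : n.-tuple A) : (u \in unpaired x n) =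
    (u \in S) && (([tuple of rev u] == u) || ([tuple of rev u] \notin S)).
  by rewrite in_set.
have [/andP[w'S ne]|alone] := boolP ((w' \in S) && (w' != w)).
  rewrite w'S (bigD1 w) ?eqxx//= (big_pred1 w').
    by rewrite !QE wS w'E ww' wS w'S (eq_sym w w') (negPf ne).
  move=> u; rewrite andbT; have [->|_] /= := eqVneq u w; last exact: andbT.
  by rewrite [RHS]eq_sym (negPf ne).
rewrite (big_pred1 w) => [|u /=].
  by rewrite QE wS w'E /=; move: alone; rewrite negb_and negbK orbC => ->.
case: (eqVneq u w) => //= uw; apply/negbTE/negP => /andP[/eqP uw' w'S].
by rewrite w'S -uw' uw in alone.
Qed.

Lemma unpaired_closed x n (w : n.-tuple A) : reversal_closed x n ->
  (w \in unpaired x n) = ([tuple of rev w] == w) && (w \in factors x n).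
Proof.
move=> cl; rewrite in_set andbC; have [wF|//] := boolP (w \in _); last first.
  by rewrite !andbF.
suff -> : [tuple of rev w] \in factors x n by rewrite orbF.
by apply/mem_factors/cl; [rewrite size_tuple|apply/mem_factors].
Qed.

Lemma unpaired_closedP x n (w : n.-tuple A) : reversal_closed x n ->
  reflect (rev w = w /\ factor x w) (w \in unpaired x n).
Proof.
move=> cl; rewrite unpaired_closed// -val_eqE.
by apply: (iffP andP) => -[/eqP wpal /mem_factors].
Qed.

Lemma unpaired0_closed x n : #|unpaired x n| = 0 -> reversal_closed x n.
Proof.
move=> /eqP; rewrite cards_eq0 => /eqP Q0 w /eqP sw fw.
have : Tuple sw \notin unpaired x n by rewrite Q0 in_set0.
rewrite in_set negb_and; case/orP => [/negP[]|]; first exact/mem_factors.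
by rewrite negb_or negbK => /andP[_ /mem_factors].
Qed.

Definition strip n (w : n.+2.-tuple A) : n.-tuple A :=
  belast_word [tuple of behead w].

Lemma stripE n (w : n.+2.-tuple A) a v b :
  tval w = a :: rcons v b -> tval (strip w) = v.
Proof. by move=> wE; rewrite /= wE /= rev_rcons /= revK. Qed.

Lemma palindromeP n (w : n.+2.-tuple A) : rev w = w ->
  exists a, tval w = a :: rcons (strip w) a.
Proof.
have := size_tuple w; case wE: (tval w) => [//|a u].
case/lastP: u wE => [//|v b] wE _; rewrite rev_cons rev_rcons => -[<- _].
by exists b; rewrite (stripE wE).
Qed.

Lemma strip_palindrome n (w : n.+2.-tuple A) : rev w = w ->
  rev (strip w) = strip w.
Proof.
move=> wpal; have [a wE] := palindromeP wpal.
move: wpal; rewrite wE rev_cons rev_rcons => -[/eqP].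
by rewrite eqseq_rcons => /andP[/eqP].
Qed.

Lemma leq_card_unpaired x k :
  ~ eventually_periodic x -> reversal_closed x k.+2 ->
  factor_complexity x k.+1 <= factor_complexity x k + 1 ->
  #|unpaired x k| <= #|unpaired x k.+2|.
Proof.
move=> aper cl2 le; have cl := reversal_closedW (reversal_closedW cl2).
apply: leq_trans (leq_imset_card (@strip k) _).
apply/subset_leq_card/subsetP => v /(unpaired_closedP _ cl)[vpal fv].
have [a fa] := palindrome_extend aper cl2 le (size_tuple v) vpal fv.
have -> : v = strip [tuple of a :: rcons v a].
  by apply: val_inj; rewrite [RHS](@stripE _ _ a v a).
apply/imset_f/(unpaired_closedP _ cl2); split=> //=.
by rewrite rev_cons rev_rcons vpal.
Qed.

(* Two palindromic extensions [a v a] and [b v b] would make [v] right special,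
   and then both [a :: v] and [b :: v] right special as well. *)
Lemma sturmian_card_unpaired x k :
  ~ eventually_periodic x -> sturmian x ->
  #|unpaired x k.+2| <= #|unpaired x k|.
Proof.
move=> aper st; have cl := sturmian_reversal_closed aper st.
have le n : factor_complexity x n.+1 <= factor_complexity x n + 1.
  by rewrite !st; lia.
have inj : {in unpaired x k.+2 &, injective (@strip k)}.
  move=> w1 w2 /(unpaired_closedP _ (cl _))[/palindromeP[a w1E] f1].
  move=> /(unpaired_closedP _ (cl _))[/[dup] wpal /palindromeP[b w2E] f2] s12.
  apply: val_inj; rewrite /= w1E w2E s12.
  rewrite w1E s12 in f1; rewrite w2E in f2.
  have vpal := strip_palindrome wpal.
  move: {w1 w1E w2E wpal s12} (strip w2) f1 f2 vpal => v fa fb vpal.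
  have [->//|ab] := eqVneq a b.
  have sv := size_tuple v.
  have flip c d : factor x (c :: rcons v d) -> factor x (d :: rcons v c).
    move/(cl k.+2); rewrite /= size_rcons sv => /(_ erefl).
    by rewrite rev_cons rev_rcons vpal.
  have [w' [c [d [sw cd]]]] := right_special_exists k.+1 aper.
  case: w' sw => [//|e w] /= [sw] fc fd.
  have vw := right_special_unique (le k) sv sw ab (factor_behead fa)
    (factor_behead fb) cd (factor_behead fc) (factor_behead fd).
  have two g : factor x (rcons v g) -> g = a \/ g = b.
    exact: (right_special_two_letters (le k) sv ab (factor_behead fa)
      (factor_behead fb)).
  rewrite -vw in fc fd.
  (* The letters [c] and [d] are [a] and [b] in some order, and [e] is one of them, so [e v c] or
     [e v d] has different end letters. *)
  have fab : factor x (a :: rcons v b).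
    have [ea|eb] := two _ (factor_behead (flip _ _ fc));
    have [ca|cb] := two _ (factor_behead fc);
    have [da|db] := two _ (factor_behead fd); subst => //; try exact: flip.
      by rewrite eqxx in cd.
    by rewrite eqxx in cd.
  have sav g : size (g :: v) = k.+1 by rewrite /= sv.
  have [] := right_special_unique (v1 := a :: v) (v2 := b :: v) (le k.+1)
    (sav a) (sav b) ab fa fab ab (flip _ _ fab) fb.
  by move/eqP; rewrite (negPf ab).
rewrite -(card_in_imset inj).
apply/subset_leq_card/subsetP => _ /imsetP[w + ->].
move=> /(unpaired_closedP _ (cl _))[wpal fw]; apply/(unpaired_closedP _ (cl _)).
split; first exact: strip_palindrome.
have [a wE] := palindromeP wpal; rewrite wE in fw.
exact: factor_belast (factor_behead fw).
Qed.

Lemma card_unpaired0 x : #|unpaired x 0| = 1.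
Proof.
rewrite -(cards1 ([tuple] : 0.-tuple A)).
apply: eq_card => w; rewrite (tuple0 w) in_set1 eqxx in_set -val_eqE andbT.
exact/mem_factors/(factor_word x 0 0).
Qed.

Lemma card_unpaired1 x : #|unpaired x 1| = factor_complexity x 1.
Proof.
apply: eq_card => w; rewrite in_set -val_eqE /=.
by case: w => -[//|a [|//]] sw; rewrite eqxx andbT.
Qed.

(** * The lower bound and the case of equality *)

Lemma reflection_complexity_ge x n : ~ eventually_periodic x ->
  1 <= n -> 1 + (n + 1) %/ 2 <= reflection_complexity x n.
Proof.
move=> aper n1; rewrite leqNgt; apply/negP => lt.
have dbl := reflection_complexity_double x n; have mh := morse_hedlund n aper.
(* In n + 1 <= rho(n) + q(n) = 2 r(n) <= 2 floor((n + 1) / 2) <= n + 1 every inequality is an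
   equality. *)
have nodd : odd n by lia.
have Q0 : #|unpaired x n| = 0 by lia.
have rho_n : factor_complexity x n = n.+1 by lia.
have cl := unpaired0_closed Q0.
(* Since rho increases strictly, its minimal value at [n] forces minimal values at all smaller
   lengths. *)
have rho k : k <= n -> factor_complexity x k = k.+1.
  move=> kn; have := factor_complexity_leD k (n - k) aper.
  by rewrite subnKC// rho_n; have := morse_hedlund k aper; lia.
have Q_gt0 m : m.*2.+1 <= n -> 0 < #|unpaired x m.*2.+1|.
  elim: m => [|m IH] mn; first by rewrite card_unpaired1 rho.
  apply: (@leq_trans #|unpaired x m.*2.+1|); first by apply: IH; lia.
  apply: leq_card_unpaired => //; last by rewrite !rho; lia.
  exact: reversal_closed_le cl.
have nE : n./2.*2.+1 = n by lia.
by have := Q_gt0 n./2; rewrite nE leqnn Q0 => /(_ isT).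
Qed.

Lemma sturmian_reflection_complexity x n : ~ eventually_periodic x ->
  sturmian x -> 1 <= n -> reflection_complexity x n = 1 + (n + 1) %/ 2.
Proof.
move=> aper st n1; have ge := reflection_complexity_ge aper n1.
have dbl := reflection_complexity_double x n; rewrite st in dbl.
have Q_le : #|unpaired x n| <= (odd n).+1.
  rewrite -(odd_double_half n) oddD odd_double addbF oddb.
  elim: (n./2) => [|m IH].
    by case: (odd n); rewrite ?card_unpaired0// card_unpaired1 st.
  by rewrite doubleS !addnS (leq_trans _ IH)// sturmian_card_unpaired.
lia.
Qed.

(* At the first length [k.+2] where the factor complexity exceeds its minimum,
   doubling [r (k + 2) = r k + 1] leaves fewer palindromes of length [k.+2] than
   of length [k]. *)
Lemma reflection_complexity_sturmian x : ~ eventually_periodic x ->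
  (forall n, 1 <= n -> reflection_complexity x n = 1 + (n + 1) %/ 2) ->
  sturmian x.
Proof.
move=> aper r; have dbl := reflection_complexity_double x.
have mh n := morse_hedlund n aper.
elim/ltn_ind => -[|[|k]] IH; first by rewrite factor_complexity0.
  by have := dbl 1; rewrite card_unpaired1 r//; lia.
have rho0 : factor_complexity x k = k + 1 by apply: IH; lia.
have rho1 : factor_complexity x k.+1 = k.+1 + 1 by apply: IH; lia.
have := mh k.+2; rewrite leq_eqVlt => /orP[/eqP <-|gt]; first by rewrite addn1.
(* At an even length m, 2 r(m) = m + 2, so rho(m) >= m + 2 forces q(m) = 0. Take m = k + 2 for even
   [k] and m = k + 3 for odd [k]. *)
have cl : reversal_closed x k.+2.
  have [ko|ke] := boolP (odd k).
    apply/reversal_closedW/unpaired0_closed.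
    have := dbl k.+3; rewrite r//; have := factor_complexity_ltS k.+2 aper; lia.
  by apply/unpaired0_closed; have := dbl k.+2; rewrite r//; lia.
have le : #|unpaired x k| <= #|unpaired x k.+2|.
  by apply: leq_card_unpaired => //; rewrite rho0 rho1; lia.
(* The assumed formula for r starts at length 1, so [k = 0] relies on q(0) = 1 instead. *)
have := dbl k.+2; rewrite r//; have [k0|k_gt0] := posnP k.
  by rewrite k0 in gt le *; rewrite card_unpaired0 in le; lia.
by have := dbl k; rewrite r// rho0; lia.
Qed.

End Words.

Theorem theorem6p1 (A : finType) (x : nat -> A)
    (hx : ~ eventually_periodic x) :
  (forall n : nat, 1 <= n -> 1 + (n + 1) %/ 2 <= reflection_complexity x n) /\
  ((forall n : nat, 1 <= n -> reflection_complexity x n = 1 + (n + 1) %/ 2) <->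
   sturmian x).
Proof.
split=> [n|]; first exact: reflection_complexity_ge.
split=> [|st n]; first exact: reflection_complexity_sturmian.
exact: sturmian_reflection_complexity.
Qed.
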